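(* Let $v(0)\in\mathcal N^*$ with $v_1(0)>0$, and let $v(t)$ be the solution of the critical equations with initial condition $v(0)$. Then for every $k\ge1$ $$\lim_{t\to\infty}t\,v_k(t)=\frac{k^{k-1}}{k!}e^{-k}\qquad\text{and}\qquad\lim_{t\to\infty}t\,m_0(t)=1.$$
   Context: $\mathcal N$: sequences $v=(v_k)_{k\ge1}$ of nonnegative reals with $\sum_kv_k<\infty$; $\mathcal N^*$: those with finitely many nonzero terms; $m_0=\sum_kv_k$. Critical equations: $v(t)\in\mathcal N$ with $v_k(t)=v_k(0)+\int_0^t\big(\tfrac k2\sum_{l=1}^{k-1}v_l(s)v_{k-l}(s)-kv_k(s)m_0(s)\big)ds$ for all $k\ge1$, with $\Phi(t)=m_0(0)-m_0(t)$ nondecreasing with values in $[0,m_0(0))$; the solution is unique. *)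

(* Defs.v *)
From Stdlib Require Import Reals List Factorial.
From Coquelicot Require Import Coquelicot.
Open Scope R_scope.

(* A sequence (v_k)_{k>=1} is represented by u : nat -> R; only indices k >= 1
   are meaningful (the value at index 0 is ignored). *)

Definition inN (u : nat -> R) : Prop :=
  (forall k, (1 <= k)%nat -> 0 <= u k) /\ ex_series (fun n => u (S n)).

Definition inNstar (u : nat -> R) : Prop :=
  inN u /\ exists N : nat, forall k, (N < k)%nat -> u k = 0.

Definition m0 (u : nat -> R) : R := Series (fun n => u (S n)).

Definition conv (u : nat -> R) (k : nat) : R :=
  fold_right Rplus 0 (map (fun l => u l * u (k - l)%nat) (seq 1 (k - 1))).

Definition critical_solution (v : R -> nat -> R) : Prop :=
  (forall t, 0 <= t -> inN (v t)) /\
  (forall t k, 0 <= t -> (1 <= k)%nat ->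
     is_RInt (fun s => INR k / 2 * conv (v s) k - INR k * v s k * m0 (v s))
             0 t (v t k - v 0 k)) /\
  (forall s t, 0 <= s -> s <= t -> m0 (v 0) - m0 (v s) <= m0 (v 0) - m0 (v t)) /\
  (forall t, 0 <= t -> 0 <= m0 (v 0) - m0 (v t) < m0 (v 0)).

(* Main.v *)
Require Import Defs.
From Stdlib Require Import Reals Factorial.
From Coquelicot Require Import Coquelicot.
From Stdlib Require Import List Lra Lia.
Open Scope R_scope.

(** Set [tau k = k^(k-1)/k!].  The quotients [w_k = v_k / v_1^k] satisfy
    [w_k' = (k/2) sum_l w_l w_(k-l)], which no longer involves [m_0] and has, by Abel's
    identity, the explicit solutions [tau k (t + d)^(k-1)].  Comparing initial values
    (this is where finite support enters) gives, for some [d > 0],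
    [tau k t^(k-1) v_1^k <= v_k <= tau k (t + d)^(k-1) v_1^k].
    By the lower bound, convergence of [sum_k v_k] forces [t v_1 <= 1/e].  By the upper
    bound and [sum_k tau k a^k <= a e] for [a <= 1/e], the quantity [(t + d) v_1]
    increases as long as it is below a given level [a < 1/e], fast enough to reach it.
    Hence [t v_1 -> 1/e], and the two bounds give the limit of [t v_k].  Finally
    [v_1' = - m_0 v_1] with [m_0] nonincreasing makes [v_1] convex, and comparing [v_1]
    at [t] and [mu t] yields [t m_0 -> 1].  Since [m_0] is only known to be
    right-continuous, all differential inequalities use right derivatives. *)

(** * Right derivatives *)

(* Coquelicot states equalities of reals in carriers on which [ring] finds no ring. *)
Ltac real_eq := cbv beta; match goal with |- @eq _ ?a ?b => change (@eq R a b) end.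

(** Let [c] be the supremum of the points up to which [P] holds throughout. The closedness step
    gives [P c], and the step to the right would push past [c] unless [c = b]. *)
Lemma real_induction (P : R -> Prop) (a b : R) :
  a <= b -> P a ->
  (forall t, a <= t < b -> P t -> at_right t P) ->
  (forall t, a < t <= b -> (forall s, a <= s < t -> P s) -> P t) ->
  P b.
Proof.
  intros hab hPa hright hleft.
  set (E := fun t => a <= t <= b /\ forall s, a <= s <= t -> P s).
  assert (hEa : E a).
  { split; [lra|]. intros s hs. now replace s with a by lra. }
  destruct (completeness E) as [c [hub hlub]].
  { exists b. intros t [ht _]. lra. }
  { now exists a. }
  assert (hac : a <= c) by now apply hub.
  assert (hcb : c <= b) by (apply hlub; intros t [ht _]; lra).
  assert (hbelow : forall s, a <= s < c -> P s).
  { intros s hs. apply Classical_Prop.NNPP. intros hn.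
    apply (Rlt_not_le c s); [lra|]. apply hlub. intros t [ht htP].
    apply Rnot_lt_le. intros hst. apply hn, htP. lra. }
  assert (hc : P c).
  { destruct (Req_dec a c) as [<-|hne]; [assumption|]. apply hleft; [lra|assumption]. }
  destruct (Req_dec c b) as [<-|hne]; [assumption|].
  destruct (hright c ltac:(lra) hc) as [eps heps].
  pose proof (cond_pos eps) as hpos.
  set (t := Rmin (c + eps / 2) b).
  assert (hct : c < t) by (apply Rmin_glb_lt; lra).
  assert (htb : t <= b) by apply Rmin_r.
  assert (hte : t <= c + eps / 2) by apply Rmin_l.
  enough (t <= c) by lra.
  apply hub. split; [lra|]. intros s hs.
  destruct (Rlt_le_dec s c) as [h|h]; [apply hbelow; lra|].
  destruct (Req_dec c s) as [<-|hcs]; [assumption|].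
  apply heps; [|lra].
  change (Rabs (s - c) < eps). rewrite Rabs_right; lra.
Qed.

Definition right_derivative (f : R -> R) (t l : R) : Prop :=
  filterlim (fun s => (f s - f t) / (s - t)) (at_right t) (locally l).

Lemma at_right_lt (t : R) : at_right t (fun s => t < s).
Proof. exists (mkposreal 1 Rlt_0_1). now intros. Qed.

Lemma filterlim_at_right_id (t : R) : filterlim (fun s => s) (at_right t) (locally t).
Proof. intros P [e he]. exists e. intros s hs _. now apply he. Qed.

Lemma filterlim_Rplus {T} {F : (T -> Prop) -> Prop} {FF : Filter F}
  (f g : T -> R) (a b : R) :
  filterlim f F (locally a) -> filterlim g F (locally b) ->
  filterlim (fun x => f x + g x) F (locally (a + b)).
Proof.
  intros hf hg. eapply filterlim_comp_2; [exact hf|exact hg|].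
  apply (filterlim_plus a b).
Qed.

Lemma filterlim_Rmult {T} {F : (T -> Prop) -> Prop} {FF : Filter F}
  (f g : T -> R) (a b : R) :
  filterlim f F (locally a) -> filterlim g F (locally b) ->
  filterlim (fun x => f x * g x) F (locally (a * b)).
Proof.
  intros hf hg. eapply filterlim_comp_2; [exact hf|exact hg|].
  apply (filterlim_mult a b).
Qed.

Lemma filterlim_Rinv {T} {F : (T -> Prop) -> Prop} {FF : Filter F}
  (f : T -> R) (a : R) :
  a <> 0 -> filterlim f F (locally a) ->
  filterlim (fun x => / f x) F (locally (/ a)).
Proof.
  intros ha hf. eapply filterlim_comp; [exact hf|].
  apply (continuous_Rinv a ha).
Qed.

Lemma right_derivative_continuous (f : R -> R) (t l : R) :
  right_derivative f t l -> filterlim f (at_right t) (locally (f t)).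
Proof.
  intros h.
  apply filterlim_ext_loc with (fun s => f t + (s + - t) * ((f s - f t) / (s - t))).
  { generalize (at_right_lt t). apply filter_imp. intros s hs. real_eq. field. lra. }
  replace (locally (f t)) with (locally (f t + (t + - t) * l)) by (f_equal; ring).
  apply filterlim_Rplus; [apply filterlim_const|].
  apply filterlim_Rmult; [|exact h].
  apply filterlim_Rplus; [apply filterlim_at_right_id|apply filterlim_const].
Qed.

Lemma right_derivative_plus (f g : R -> R) (t l m : R) :
  right_derivative f t l -> right_derivative g t m ->
  right_derivative (fun s => f s + g s) t (l + m).
Proof.
  intros hf hg.
  eapply filterlim_ext; [|apply (filterlim_Rplus _ _ _ _ hf hg)].
  intros s. real_eq. unfold Rdiv. ring.
Qed.

Lemma right_derivative_mult (f g : R -> R) (t l m : R) :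
  right_derivative f t l -> right_derivative g t m ->
  right_derivative (fun s => f s * g s) t (l * g t + f t * m).
Proof.
  intros hf hg.
  eapply filterlim_ext;
    [|apply filterlim_Rplus;
      [apply (filterlim_Rmult _ (fun _ => g t) _ _ hf); apply filterlim_const
      |apply (filterlim_Rmult f _ _ _ (right_derivative_continuous _ _ _ hf) hg)]].
  intros s. real_eq. unfold Rdiv. ring.
Qed.

Lemma right_derivative_scal (c : R) (f : R -> R) (t l : R) :
  right_derivative f t l -> right_derivative (fun s => c * f s) t (c * l).
Proof.
  intros hf.
  eapply filterlim_ext; [|apply (filterlim_Rmult (fun _ => c) _ _ _ (filterlim_const c) hf)].
  intros s. real_eq. unfold Rdiv. ring.
Qed.

Lemma right_derivative_of_is_derive (f : R -> R) (t l : R) :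
  is_derive f t l -> right_derivative f t l.
Proof.
  intros h. apply is_derive_Reals in h.
  apply filterlim_locally. intros eps.
  destruct (h eps (cond_pos eps)) as [d hd].
  exists d. intros s hs hts.
  change (Rabs (s - t) < d) in hs.
  change (Rabs ((f s - f t) / (s - t) - l) < eps).
  specialize (hd (s - t) ltac:(lra) hs).
  now rewrite Rplus_minus in hd.
Qed.

Lemma right_derivative_inv (f : R -> R) (t l : R) :
  (forall s, t <= s -> f s <> 0) -> right_derivative f t l ->
  right_derivative (fun s => / f s) t (- l * / f t * / f t).
Proof.
  intros hne hf.
  apply filterlim_ext_loc
    with (fun s => -1 * ((f s - f t) / (s - t)) * / f s * / f t).
  { generalize (at_right_lt t). apply filter_imp. intros s hs. real_eq. field.
    repeat split; first [lra | apply hne; lra]. }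
  replace (- l) with (-1 * l) by ring.
  apply filterlim_Rmult; [|apply filterlim_const].
  apply filterlim_Rmult.
  - apply filterlim_Rmult; [apply filterlim_const|exact hf].
  - apply filterlim_Rinv; [apply hne; lra|].
    now apply right_derivative_continuous with l.
Qed.

(** Phrased through the logarithmic derivative [m], the power rule needs no exponent [k - 1], and
    [k = 0] is no exception. *)
Lemma right_derivative_pow (f : R -> R) (t m : R) (k : nat) :
  right_derivative f t (m * f t) ->
  right_derivative (fun s => f s ^ k) t (INR k * m * f t ^ k).
Proof.
  intros hf. induction k as [|k IH].
  - simpl. replace (0 * m * 1) with 0 by ring.
    apply right_derivative_of_is_derive, is_derive_Reals, derivable_pt_lim_const.
  - replace (INR (S k) * m * f t ^ S k)
      with (m * f t * f t ^ k + f t * (INR k * m * f t ^ k))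
      by (rewrite S_INR; simpl; ring).
    exact (right_derivative_mult _ _ _ _ _ hf IH).
Qed.

Lemma at_right_lt_of_right_derivative_pos (f : R -> R) (t l : R) :
  0 < l -> right_derivative f t l -> at_right t (fun s => f t < f s).
Proof.
  intros hl hf.
  generalize (filter_and _ _
    (proj1 (filterlim_locally _ _) hf (mkposreal l hl)) (at_right_lt t)).
  apply filter_imp. intros s [hs hts].
  change (Rabs ((f s - f t) / (s - t) - l) < l) in hs.
  assert (hq : 0 < (f s - f t) / (s - t)) by (apply Rabs_def2 in hs; lra).
  apply Rmult_lt_compat_r with (r := s - t) in hq; [|lra].
  replace ((f s - f t) / (s - t) * (s - t)) with (f s - f t) in hq by (field; lra).
  lra.
Qed.

(** The level [c] cannot be crossed downwards. Where [f t > c], right continuity keeps [f] above [c]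
    for a while; where [f t = c], the positive right derivative does. Continuity passes the
    inequality to limits from the left. *)
Lemma right_derivative_barrier (f : R -> R) (a b c : R) :
  a <= b -> c <= f a ->
  (forall t, a < t <= b -> continuous f t) ->
  (forall t, a <= t < b -> exists l, right_derivative f t l /\ (f t = c -> 0 < l)) ->
  c <= f b.
Proof.
  intros hab hfa hcont hder.
  apply (real_induction (fun t => c <= f t) a b hab hfa).
  - intros t ht hct. destruct (hder t ht) as [l [hl hpos]].
    destruct (Req_dec (f t) c) as [heq|hne].
    + generalize (at_right_lt_of_right_derivative_pos f t l (hpos heq) hl).
      apply filter_imp. intros s hs. lra.
    + assert (hgap : 0 < f t - c) by lra.
      generalize (proj1 (filterlim_locally f (f t))
        (right_derivative_continuous _ _ _ hl) (mkposreal _ hgap)).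
      apply filter_imp. intros s hs.
      change (Rabs (f s - f t) < f t - c) in hs.
      apply Rabs_def2 in hs. lra.
  - intros t ht hbelow. apply Rnot_lt_le. intros hlt.
    assert (hgap : 0 < c - f t) by lra.
    destruct (proj1 (filterlim_locally f (f t)) (hcont t ht) (mkposreal _ hgap))
      as [d hd].
    pose proof (cond_pos d) as hdpos.
    set (s := Rmax a (t - d / 2)).
    assert (has : a <= s) by apply Rmax_l.
    assert (hds : t - d / 2 <= s) by apply Rmax_r.
    assert (hst : s < t) by (apply Rmax_lub_lt; lra).
    assert (hs : Rabs (f s - f t) < c - f t).
    { apply (hd s). change (Rabs (s - t) < d). rewrite Rabs_left; lra. }
    apply Rabs_def2 in hs. specialize (hbelow s ltac:(lra)). lra.
Qed.

Lemma right_derivative_nonneg_incr (f df : R -> R) (a b : R) :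
  a <= b ->
  (forall t, a < t <= b -> continuous f t) ->
  (forall t, a <= t < b -> right_derivative f t (df t) /\ 0 <= df t) ->
  f a <= f b.
Proof.
  intros hab hcont hder. apply le_epsilon. intros eps heps.
  (* Tilting [f] by a small slope [e] makes the right derivative strictly positive, so the barrier
     applies at level [f a]. The [+ 1] keeps the denominator positive when [a = b]. *)
  assert (he : 0 < eps / (b - a + 1)) by (apply Rdiv_lt_0_compat; lra).
  set (e := eps / (b - a + 1)) in *.
  assert (hea : e * (b - a) <= eps).
  { replace eps with (e * (b - a + 1)) by (unfold e; field; lra). nra. }
  enough (f a <= f b + e * (b - a)) by lra.
  apply (right_derivative_barrier (fun s => f s + e * (s - a)) a b (f a) hab).
  - lra.
  - intros t ht. apply (continuous_plus f (fun s => e * (s - a))); [now apply hcont|].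
    apply (ex_derive_continuous (fun s => e * (s - a))). auto_derive. trivial.
  - intros t ht. destruct (hder t ht) as [hd hnn].
    exists (df t + e). split; [|lra].
    apply right_derivative_plus; [exact hd|].
    apply right_derivative_of_is_derive. auto_derive; [trivial|ring].
Qed.

(** * Abel polynomials *)

(** Coefficients of the tree function [T(z) = z exp(T(z))]. *)
Definition tau (k : nat) : R := INR k ^ (k - 1) / INR (fact k).

(** Abel polynomials [x (x + n)^(n-1) / n!], the coefficients of [exp(x T(z))] for the tree function
    [T]. *)
Definition abel (n : nat) (x : R) : R :=
  match n with
  | O => 1
  | S m => x * (x + INR n) ^ m / INR (fact n)
  end.

Lemma is_derive_sum_f_R0 (f : nat -> R -> R) (d : nat -> R) (n : nat) (x : R) :
  (forall k, (k <= n)%nat -> is_derive (f k) x (d k)) ->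
  is_derive (fun y => sum_f_R0 (fun k => f k y) n) x (sum_f_R0 d n).
Proof.
  intros h. induction n as [|n IH]; simpl.
  - now apply h.
  - apply (is_derive_plus (fun y => sum_f_R0 (fun k => f k y) n) (f (S n))).
    + apply IH. intros k hk. apply h. lia.
    + now apply h.
Qed.

(** With [N = n + 1], the product rule gives [(x+N)^(N-1) + x (N-1) (x+N)^(N-2) = N (x+1)
    (x+N)^(N-2)], and [N] cancels in the factorial. *)
Lemma abel_derive (n : nat) (x : R) : is_derive (abel (S n)) x (abel n (x + 1)).
Proof.
  assert (hder : forall c d m, is_derive (fun y => y * (y + c) ^ m / d) x
    (((x + c) ^ m + x * (INR m * (x + c) ^ pred m)) / d)).
  { intros c d m. auto_derive; [trivial|]. unfold Rdiv. ring. }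
  specialize (hder (INR (S n)) (INR (fact (S n))) n).
  eapply eq_ind; [exact hder|]. unfold abel.
  pose proof (INR_fact_neq_0 n) as hf. pose proof (pos_INR n) as hn.
  destruct n as [|n]; [simpl; real_eq; field|]; real_eq.
  rewrite (fact_simpl (S n)), mult_INR.
  pose proof (pos_INR (S n)).
  rewrite (S_INR (S n)).
  replace (x + 1 + INR (S n)) with (x + (INR (S n) + 1)) by ring.
  cbn [pow Init.Nat.pred]. field. lra.
Qed.

Lemma abel_S_0 (n : nat) : abel (S n) 0 = 0.
Proof. unfold abel, Rdiv. ring. Qed.

(** The index shifts because [(n+1)^(n-1) / n! = (n+1)^n / (n+1)!]. *)
Lemma abel_1 (n : nat) : abel n 1 = tau (S n).
Proof.
  unfold abel, tau. destruct n as [|n]; [simpl; field|].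
  pose proof (INR_fact_neq_0 (S n)).
  rewrite (fact_simpl (S n)), mult_INR.
  replace (S (S n) - 1)%nat with (S n) by lia.
  rewrite (S_INR (S n)), (Rplus_comm 1).
  cbn [pow]. field. pose proof (pos_INR (S n)). split; lra.
Qed.

(** Abel's identity. Both sides agree at [x = 0], where only the term [l = 0] survives, and by the
    induction hypothesis at [x + 1] they have the same derivative in [x]. *)
Lemma abel_convolution (n : nat) : forall x y : R,
  abel n (x + y) = sum_f_R0 (fun l => abel l x * abel (n - l) y) n.
Proof.
  induction n as [|n IH]; intros x y; [simpl; ring|].
  set (d := fun z => abel (S n) (z + y)
              - sum_f_R0 (fun l => abel l z * abel (S n - l) y) (S n)).
  enough (hd : d x = d 0).
  { assert (h0 : d 0 = 0).
    { unfold d. rewrite decomp_sum by lia. rewrite Rplus_0_l.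
      rewrite (sum_eq _ (fun _ => 0)), sum_cte.
      - replace (S n - 0)%nat with (S n) by lia. simpl abel at 2. ring.
      - intros i _. rewrite abel_S_0. ring. }
    unfold d in hd at 1. lra. }
  assert (hder : forall z, is_derive d z 0).
  { intros z. unfold d.
    replace 0 with (abel n (z + 1 + y) -
      (* The constant [abel 0] contributes derivative 0; dropping it lowers the index and leaves the
         convolution of order [n] at [z + 1]. *)
      sum_f_R0 (fun l => match l with O => 0 | S j => abel j (z + 1) end * abel (S n - l) y) (S n)).
    - apply (is_derive_minus (fun z => abel (S n) (z + y))).
      + replace (abel n (z + 1 + y)) with (1 * abel n (z + y + 1))
          by (rewrite Rmult_1_l; f_equal; ring).
        apply (is_derive_comp (abel (S n)) (fun z => z + y)); [apply abel_derive|].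
        auto_derive; [trivial|ring].
      + apply (is_derive_sum_f_R0 (fun l z => abel l z * abel (S n - l) y)).
        intros l _.
        rewrite Rmult_comm.
        apply is_derive_ext with (fun z => abel (S n - l) y * abel l z);
          [intros; apply Rmult_comm|].
        apply (is_derive_scal (abel l)). destruct l as [|j]; [|apply abel_derive].
        simpl. apply (@is_derive_const R_AbsRing).
    - rewrite decomp_sum by lia. rewrite IH. simpl pred.
      simpl (S n - S _)%nat. ring. }
  destruct (Rtotal_order 0 x) as [h|[h|h]].
  - symmetry. apply (eq_is_derive d 0 x); [intros; apply hder|exact h].
  - now rewrite h.
  - apply (eq_is_derive d x 0); [intros; apply hder|exact h].
Qed.

Lemma fold_right_Rplus_seq (g : nat -> R) (n : nat) : forall a,
  fold_right Rplus 0 (map g (seq a (S n))) = sum_f_R0 (fun l => g (a + l)%nat) n.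
Proof.
  induction n as [|n IH]; intros a.
  - simpl. rewrite Nat.add_0_r. ring.
  - rewrite decomp_sum by lia. simpl pred.
    change (g a + fold_right Rplus 0 (map g (seq (S a) (S n))) =
      g (a + 0)%nat + sum_f_R0 (fun i => g (a + S i)%nat) n).
    rewrite IH, Nat.add_0_r. f_equal. apply sum_eq. intros i _. f_equal. lia.
Qed.

(** With [k = n + 2], Abel's identity at [x = y = 1] sums the convolution to
    [abel n 2 = 2 k^(n-1) / n!]. Both sides then equal [k^(k-2) / (k-2)!]. *)
Lemma conv_tau (k : nat) : (2 <= k)%nat ->
  INR k / 2 * conv tau k = INR (k - 1) * tau k.
Proof.
  intros hk. destruct k as [|[|n]]; try lia. unfold conv.
  replace (S (S n) - 1)%nat with (S n) by lia.
  rewrite fold_right_Rplus_seq.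
  rewrite (sum_eq _ (fun l => abel l 1 * abel (n - l) 1)).
  2:{ intros l hl. rewrite !abel_1. f_equal; f_equal; lia. }
  rewrite <- abel_convolution.
  unfold tau, abel. destruct n as [|n]; [simpl; field|].
  replace (S (S (S n)) - 1)%nat with (S (S n)) by lia.
  pose proof (INR_fact_neq_0 (S n)).
  rewrite (fact_simpl (S (S n))), (fact_simpl (S n)), !mult_INR.
  rewrite (S_INR (S (S n))), (S_INR (S n)).
  replace (1 + 1 + INR (S n)) with (INR (S n) + 1 + 1) by ring.
  pose proof (pos_INR (S n)).
  cbn [pow]. field. repeat split; lra.
Qed.

Lemma conv_le (p q : nat -> R) (k : nat) :
  (forall l, (1 <= l < k)%nat -> 0 <= p l <= q l) -> conv p k <= conv q k.
Proof.
  intros h. unfold conv.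
  (* Only the range of the indices is retained, so that the induction can run over an arbitrary
     list. *)
  assert (hin : forall l, In l (seq 1 (k - 1)) -> (1 <= l < k)%nat)
    by (intros l hl; apply in_seq in hl; lia).
  induction (seq 1 (k - 1)) as [|l s IH]; simpl; [lra|].
  apply Rplus_le_compat.
  - assert (hl := hin l (or_introl eq_refl)).
    pose proof (h l hl). pose proof (h (k - l)%nat ltac:(lia)).
    apply Rmult_le_compat; lra.
  - apply IH. intros j hj. apply hin. now right.
Qed.

Lemma conv_scale (p : nat -> R) (c : R) (k : nat) :
  conv (fun l => p l * c ^ l) k = conv p k * c ^ k.
Proof.
  unfold conv.
  assert (hin : forall l, In l (seq 1 (k - 1)) -> (1 <= l < k)%nat)
    by (intros l hl; apply in_seq in hl; lia).
  induction (seq 1 (k - 1)) as [|l s IH]; simpl; [ring|].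
  rewrite IH by (intros j hj; apply hin; now right).
  assert (hl := hin l (or_introl eq_refl)).
  replace (c ^ k) with (c ^ l * c ^ (k - l)) by (rewrite <- pow_add; f_equal; lia).
  ring.
Qed.

(** * Bounds on the tree coefficients and their partial sums *)

Lemma tau_pos (k : nat) : (1 <= k)%nat -> 0 < tau k.
Proof.
  intros hk. apply Rdiv_lt_0_compat; [|apply INR_fact_lt_0].
  apply pow_lt, lt_0_INR. lia.
Qed.

(** The gap between [exp x] and the partial sum up to [N + 1] vanishes at 0. Its derivative is
    [exp x] minus [a] times the partial sum up to [N] at [x + 1], hence by induction at least
    [exp x - a exp(x+1) >= 0]. *)
Lemma sum_abel_le_exp (a : R) (N : nat) : 0 <= a <= exp (-1) -> forall x, 0 <= x ->
  sum_f_R0 (fun n => abel n x * a ^ n) N <= exp x.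
Proof.
  intros ha. induction N as [|N IH]; intros x hx.
  - simpl. pose proof (exp_ineq1_le x). lra.
  - set (d := fun z => exp z - sum_f_R0 (fun n => abel n z * a ^ n) (S N)).
    set (dd := fun z => exp z - a * sum_f_R0 (fun n => abel n (z + 1) * a ^ n) N).
    assert (hder : forall z, is_derive d z (dd z)).
    { intros z. apply (is_derive_minus exp); [apply is_derive_exp|].
      replace (a * sum_f_R0 (fun n => abel n (z + 1) * a ^ n) N)
        with (sum_f_R0 (fun l => match l with O => 0 | S j => abel j (z + 1) end * a ^ l) (S N)).
      - apply (is_derive_sum_f_R0 (fun l z => abel l z * a ^ l)). intros l _.
        rewrite Rmult_comm.
        apply is_derive_ext with (fun z => a ^ l * abel l z);
          [intros; apply Rmult_comm|].
        apply (is_derive_scal (abel l)). destruct l as [|j]; [|apply abel_derive].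
        simpl. apply (@is_derive_const R_AbsRing).
      - rewrite decomp_sum by lia. rewrite scal_sum, Rmult_0_l, Rplus_0_l.
        apply sum_eq. intros i _. simpl. ring. }
    assert (h0 : d 0 = 0).
    { unfold d. rewrite decomp_sum by lia. rewrite exp_0.
      rewrite (sum_eq _ (fun _ => 0)), sum_cte; [simpl; ring|].
      intros i _. rewrite abel_S_0. ring. }
    enough (d 0 <= d x) by (unfold d in *; lra).
    apply (right_derivative_nonneg_incr d dd); [exact hx| |].
    + intros t _. apply (ex_derive_continuous d). now exists (dd t).
    + intros t ht. split; [apply right_derivative_of_is_derive, hder|].
      unfold dd. specialize (IH (t + 1) ltac:(lra)).
      assert (hexp : exp t = exp (-1) * exp (t + 1)) by (rewrite <- exp_plus; f_equal; ring).
      rewrite hexp. pose proof (exp_pos (t + 1)). pose proof (exp_pos (-1)).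
      apply Rle_trans with (a * exp (t + 1) - a * sum_f_R0 (fun n => abel n (t + 1) * a ^ n) N).
      * rewrite <- Rmult_minus_distr_l. apply Rmult_le_pos; lra.
      * apply Rplus_le_compat_r, Rmult_le_compat_r; lra.
Qed.

Lemma sum_tau_le (a : R) (N : nat) : 0 <= a <= exp (-1) ->
  sum_f_R0 (fun n => tau (S n) * a ^ S n) N <= a * exp 1.
Proof.
  intros ha. pose proof (sum_abel_le_exp a N ha 1 Rle_0_1) as h.
  rewrite (sum_eq _ (fun n => abel n 1 * a ^ n * a)).
  2:{ intros n _. rewrite abel_1. simpl. ring. }
  rewrite <- scal_sum. apply Rmult_le_compat_l; lra.
Qed.

Lemma exp_1_mult_exp_opp_1 : exp 1 * exp (-1) = 1.
Proof. rewrite <- exp_plus. replace (1 + -1) with 0 by ring. apply exp_0. Qed.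

Lemma exp_INR_mult (x : R) (n : nat) : exp (INR n * x) = exp x ^ n.
Proof.
  induction n as [|n IH]; [simpl; rewrite Rmult_0_l; apply exp_0|].
  rewrite S_INR, Rmult_plus_distr_r, Rmult_1_l, exp_plus, IH. simpl. ring.
Qed.

(** A weak form of Stirling's formula: [tau] grows like [e^n] up to a polynomial factor, which
    suffices for locating a radius of convergence. *)
Lemma tau_lower_bound (n : nat) : exp 1 ^ n <= INR (S n) ^ 2 * tau (S n).
Proof.
  (* [(1 - 1/(m+2))^(m+2) <= 1/e] *)
  assert (hstep : forall m, exp 1 * INR (S m) ^ S (S m) <= INR (S (S m)) ^ S (S m)).
  { intros m. set (q := INR (S (S m))).
    assert (hq : 1 < q) by (apply (lt_INR 1); lia).
    assert (hqi : / q < 1) by (rewrite <- Rinv_1; apply Rinv_lt_contravar; lra).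
    replace (INR (S m)) with (q * (1 + - / q))
      by (unfold q in *; rewrite (S_INR (S m)) in *; field; lra).
    rewrite Rpow_mult_distr.
    assert (hpow : (1 + - / q) ^ S (S m) <= exp (-1)).
    { replace (-1) with (INR (S (S m)) * (- / q)) by (fold q; field; lra).
      rewrite exp_INR_mult. apply pow_incr. split; [lra|apply exp_ineq1_le]. }
    pose proof exp_1_mult_exp_opp_1 as he.
    pose proof (exp_pos 1). pose proof (pow_lt q (S (S m)) ltac:(lra)).
    apply Rle_trans with (exp 1 * (q ^ S (S m) * exp (-1))).
    - apply Rmult_le_compat_l, Rmult_le_compat_l; lra.
    - apply Req_le. rewrite (Rmult_comm (q ^ _)), <- Rmult_assoc, he. ring. }
  (* The claim with denominators cleared. Passing from [n] to [n + 1] multiplies the left side by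
     [e (n+2)], and [hstep] absorbs the factor [e]. *)
  assert (hmain : exp 1 ^ n * INR (fact (S n)) <= INR (S n) ^ S (S n)).
  { induction n as [|n IH]; [simpl; lra|].
    rewrite (fact_simpl (S n)), mult_INR.
    apply Rle_trans with (exp 1 * INR (S n) ^ S (S n) * INR (S (S n))).
    - replace (exp 1 ^ S n * (INR (S (S n)) * INR (fact (S n))))
        with (exp 1 * (exp 1 ^ n * INR (fact (S n))) * INR (S (S n))) by (cbn [pow]; ring).
      apply Rmult_le_compat_r; [apply pos_INR|].
      apply Rmult_le_compat_l; [left; apply exp_pos|exact IH].
    - change (INR (S (S n)) ^ S (S (S n))) with (INR (S (S n)) * INR (S (S n)) ^ S (S n)).
      rewrite (Rmult_comm (INR (S (S n)))).
      apply Rmult_le_compat_r; [apply pos_INR|apply hstep]. }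
  pose proof (INR_fact_lt_0 (S n)) as hf.
  unfold tau. replace (S n - 1)%nat with n by lia.
  apply Rmult_le_reg_r with (INR (fact (S n))); [exact hf|].
  replace (INR (S n) ^ 2 * (INR (S n) ^ n / INR (fact (S n))) * INR (fact (S n)))
    with (INR (S n) ^ S (S n)) by (cbn [pow]; field; lra).
  exact hmain.
Qed.

(* Bernoulli's inequality along multiples of 3. *)
Lemma geometric_le_quadratic (q C : R) :
  0 <= q -> (forall n, q ^ n <= C * INR (S n) ^ 2) -> q <= 1.
Proof.
  intros hq0 h. apply Rnot_lt_le. intros hq.
  set (e := q - 1). assert (he : 0 < e) by (unfold e; lra).
  assert (hC : 0 < C) by (specialize (h 0%nat); simpl in h; lra).
  assert (he3 : 0 < e ^ 3) by now apply pow_lt.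
  (* For [m >= 1], [(m e)^3 <= q^(3m) <= C (3m+1)^2 <= 16 C m^2], which fails once
     [m e^3 > 16 C]. *)
  destruct (INR_unbounded (16 * C / e ^ 3 + 1)) as [m hm].
  assert (hm1 : 1 < INR m).
  { assert (0 < 16 * C / e ^ 3) by (apply Rdiv_lt_0_compat; lra). lra. }
  assert (hlow : (INR m * e) ^ 3 <= q ^ (m * 3)).
  { rewrite pow_mult. apply pow_incr. split; [nra|].
    pose proof (poly m e he) as hb. replace (1 + e) with q in hb by (unfold e; ring). lra. }
  specialize (h (m * 3)%nat). rewrite S_INR, mult_INR in h. simpl (INR 3) in h.
  assert (hup : C * (INR m * (1 + 1 + 1) + 1) ^ 2 <= C * (16 * INR m ^ 2)).
  { apply Rmult_le_compat_l; [lra|]. simpl. nra. }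
  assert (hbig : 16 * C < INR m * e ^ 3).
  { replace (16 * C) with (16 * C / e ^ 3 * e ^ 3) by (field; lra).
    apply Rmult_lt_compat_r; lra. }
  assert (hm2 : 0 < INR m ^ 2) by (apply pow_lt; lra).
  replace ((INR m * e) ^ 3) with (INR m ^ 2 * (INR m * e ^ 3)) in hlow by ring.
  nra.
Qed.

(** * Regularity of solutions *)

Lemma sum_le_m0 (u : nat -> R) (n : nat) :
  inN u -> sum_f_R0 (fun i => u (S i)) n <= m0 u.
Proof.
  intros [hpos hex]. rewrite <- sum_n_Reals.
  apply (is_lim_seq_incr_compare (sum_n (fun i => u (S i)))).
  - exact (Series_correct _ hex).
  - intros i. rewrite sum_Sn. unfold plus. simpl.
    specialize (hpos (S (S i)) ltac:(lia)). lra.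
Qed.

Lemma term_le_m0 (u : nat -> R) (k : nat) : inN u -> (1 <= k)%nat -> u k <= m0 u.
Proof.
  intros hu hk. destruct k as [|k]; [lia|].
  apply Rle_trans with (2 := sum_le_m0 u k hu).
  destruct k as [|k]; [simpl; lra|]. simpl.
  enough (0 <= sum_f_R0 (fun i => u (S i)) k) by lra.
  apply cond_pos_sum. intros i. apply hu. lia.
Qed.

Lemma m0_le (u : nat -> R) (M : R) :
  inN u -> (forall n, sum_f_R0 (fun i => u (S i)) n <= M) -> m0 u <= M.
Proof.
  intros [_ hex] h.
  apply (is_lim_seq_le (sum_n (fun i => u (S i))) (fun _ => M) (m0 u) M).
  - intros n. rewrite sum_n_Reals. apply h.
  - exact (Series_correct _ hex).
  - apply is_lim_seq_const.
Qed.

Lemma conv_bounds (u : nat -> R) (k : nat) (M : R) :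
  (forall l, (1 <= l)%nat -> 0 <= u l <= M) ->
  0 <= conv u k <= INR k * (M * M).
Proof.
  intros hu. unfold conv.
  enough (0 <= fold_right Rplus 0 (map (fun l => u l * u (k - l)%nat) (seq 1 (k - 1)))
    <= INR (length (seq 1 (k - 1))) * (M * M)) as hb.
  { rewrite length_seq in hb. split; [apply hb|].
    apply Rle_trans with (1 := proj2 hb). apply Rmult_le_compat_r; [nra|].
    apply le_INR. lia. }
  assert (hin : forall l, In l (seq 1 (k - 1)) -> (1 <= l < k)%nat)
    by (intros l hl; apply in_seq in hl; lia).
  induction (seq 1 (k - 1)) as [|l s IH]; [simpl; lra|].
  change (length (l :: s)) with (S (length s)). rewrite S_INR. simpl.
  assert (hl := hin l (or_introl eq_refl)).
  pose proof (hu l ltac:(lia)). pose proof (hu (k - l)%nat ltac:(lia)).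
  specialize (IH (fun j hj => hin j (or_intror hj))).
  assert (0 <= u l * u (k - l)%nat <= M * M)
    by (split; [apply Rmult_le_pos|apply Rmult_le_compat]; lra).
  lra.
Qed.

Lemma solution_m0_decr (v : R -> nat -> R) (s t : R) :
  critical_solution v -> 0 <= s <= t -> m0 (v t) <= m0 (v s).
Proof.
  intros (_ & _ & hm & _) hst. specialize (hm s t ltac:(lra) ltac:(lra)). lra.
Qed.

Lemma solution_bounds (v : R -> nat -> R) (t : R) (k : nat) :
  critical_solution v -> 0 <= t -> (1 <= k)%nat -> 0 <= v t k <= m0 (v 0).
Proof.
  intros hv ht hk. assert (hN : inN (v t)) by now apply hv.
  split; [now apply hN|].
  apply Rle_trans with (m0 (v t)); [now apply term_le_m0|].
  apply solution_m0_decr; [exact hv|lra].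
Qed.

Definition rhs (v : R -> nat -> R) (k : nat) (s : R) : R :=
  INR k / 2 * conv (v s) k - INR k * v s k * m0 (v s).

Lemma solution_increment (v : R -> nat -> R) (s t : R) (k : nat) :
  critical_solution v -> 0 <= s -> 0 <= t -> (1 <= k)%nat ->
  is_RInt (rhs v k) s t (v t k - v s k).
Proof.
  intros (_ & hint & _) hs ht hk.
  replace (v t k - v s k) with (- (v s k - v 0 k) + (v t k - v 0 k)) by ring.
  apply (@is_RInt_Chasles R_NormedModule _ s 0 t).
  - apply (@is_RInt_swap R_NormedModule). now apply hint.
  - now apply hint.
Qed.

(** For fixed [k] the integrand is bounded in terms of [k] and the initial mass, since all terms and
    the mass stay below [m0 (v 0)]. *)
Lemma solution_lipschitz (v : R -> nat -> R) (k : nat) :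
  critical_solution v -> (1 <= k)%nat -> exists K, 0 < K /\
  forall s t, 0 <= s -> 0 <= t -> Rabs (v t k - v s k) <= K * Rabs (t - s).
Proof.
  intros hv hk. set (m := m0 (v 0)).
  (* Bounds for the gain and loss terms; the [+ 1] makes [K] positive, so that it can be divided
     by. *)
  set (K := INR k / 2 * (INR k * (m * m)) + INR k * (m * m) + 1).
  assert (hk0 : 0 <= INR k) by apply pos_INR.
  assert (hm : 0 <= m * m) by nra.
  assert (hkm : 0 <= INR k * (m * m)) by now apply Rmult_le_pos.
  assert (hle : forall s t, 0 <= s <= t -> Rabs (v t k - v s k) <= K * (t - s)).
  { intros s t hst. rewrite Rmult_comm.
    apply (norm_RInt_le_const (rhs v k) s t); [lra| |].
    - intros x hx. change (Rabs (rhs v k x) <= K). unfold rhs.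
      pose proof (solution_bounds v x k hv ltac:(lra) hk) as hvk. fold m in hvk.
      assert (hmx : m0 (v x) <= m) by (apply solution_m0_decr; [exact hv|lra]).
      assert (hmx0 : 0 <= m0 (v x)).
      { apply Rle_trans with (v x k); [lra|]. apply term_le_m0; [apply hv; lra|exact hk]. }
      assert (hc : 0 <= conv (v x) k <= INR k * (m * m)).
      { apply conv_bounds. intros l hl. apply solution_bounds; [exact hv|lra|exact hl]. }
      assert (h1 : 0 <= INR k / 2 * conv (v x) k <= INR k / 2 * (INR k * (m * m))).
      { split; [apply Rmult_le_pos|apply Rmult_le_compat_l]; lra. }
      assert (h2 : 0 <= INR k * v x k * m0 (v x) <= INR k * (m * m)).
      { rewrite Rmult_assoc. split.
        - repeat apply Rmult_le_pos; lra.
        - apply Rmult_le_compat_l; [lra|]. apply Rmult_le_compat; lra. }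
      unfold K. apply Rabs_le. lra.
    - apply solution_increment; [exact hv|lra|lra|exact hk]. }
  exists K. split.
  - unfold K. assert (0 <= INR k / 2 * (INR k * (m * m))) by (apply Rmult_le_pos; lra). lra.
  - intros s t hs ht. destruct (Rle_lt_dec s t) as [h|h].
    + rewrite (Rabs_pos_eq (t - s)) by lra. apply hle. lra.
    + rewrite Rabs_minus_sym, (Rabs_minus_sym t), (Rabs_pos_eq (s - t)) by lra.
      apply hle. lra.
Qed.

(** A general filter concentrated on times [s >= 0] covers both two-sided continuity at [t > 0] and
    right continuity at [t >= 0]. *)
Lemma solution_filterlim (v : R -> nat -> R) (k : nat) (t : R)
  (F : (R -> Prop) -> Prop) {FF : Filter F} :
  critical_solution v -> (1 <= k)%nat -> 0 <= t ->
  filterlim (fun s => s) F (locally t) -> F (fun s => 0 <= s) ->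
  filterlim (fun s => v s k) F (locally (v t k)).
Proof.
  intros hv hk ht hF hF0.
  destruct (solution_lipschitz v k hv hk) as (K & hK & hlip).
  apply filterlim_locally. intros eps.
  assert (he : 0 < eps / K) by (apply Rdiv_lt_0_compat; [apply cond_pos|exact hK]).
  generalize (filter_and _ _ (proj1 (filterlim_locally _ _) hF (mkposreal _ he)) hF0).
  apply filter_imp. intros s [hs hs0].
  change (Rabs (s - t) < eps / K) in hs. change (Rabs (v s k - v t k) < eps).
  apply Rle_lt_trans with (1 := hlip t s ht hs0).
  replace (pos eps) with (K * (eps / K)) by (field; lra).
  now apply Rmult_lt_compat_l.
Qed.

Lemma solution_continuous (v : R -> nat -> R) (k : nat) (t : R) :
  critical_solution v -> (1 <= k)%nat -> 0 < t -> continuous (fun s => v s k) t.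
Proof.
  intros hv hk ht. apply solution_filterlim; [apply locally_filter|exact hv|exact hk|lra| |].
  - apply filterlim_id.
  - exists (mkposreal t ht). intros s hs. change (Rabs (s - t) < t) in hs.
    apply Rabs_def2 in hs. lra.
Qed.

Lemma solution_right_continuous (v : R -> nat -> R) (k : nat) (t : R) :
  critical_solution v -> (1 <= k)%nat -> 0 <= t ->
  filterlim (fun s => v s k) (at_right t) (locally (v t k)).
Proof.
  intros hv hk ht. apply solution_filterlim; [apply at_right_proper_filter|exact hv|exact hk|exact ht| |].
  - apply filterlim_at_right_id.
  - generalize (at_right_lt t). apply filter_imp. intros s hs. lra.
Qed.

Lemma filterlim_sum_f_R0 {T} {F : (T -> Prop) -> Prop} {FF : Filter F}
  (f : nat -> T -> R) (a : nat -> R) (n : nat) :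
  (forall i, filterlim (f i) F (locally (a i))) ->
  filterlim (fun x => sum_f_R0 (fun i => f i x) n) F (locally (sum_f_R0 a n)).
Proof.
  intros h. induction n as [|n IH]; simpl; [apply h|].
  now apply filterlim_Rplus.
Qed.

(* Total mass is a supremum of continuous functions, hence lower semicontinuous;
   being nonincreasing it is then right-continuous. *)
Lemma m0_right_continuous (v : R -> nat -> R) (t : R) :
  critical_solution v -> 0 <= t ->
  filterlim (fun s => m0 (v s)) (at_right t) (locally (m0 (v t))).
Proof.
  intros hv ht. apply filterlim_locally. intros eps.
  assert (hN : inN (v t)) by now apply hv.
  pose proof (Series_correct _ (proj2 hN)) as hser.
  assert (heps2 : 0 < eps / 2) by (pose proof (cond_pos eps); lra).
  destruct (proj1 (filterlim_locally _ _) hser (mkposreal _ heps2)) as [n hn].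
  specialize (hn n (le_n n)).
  change (Rabs (sum_n (fun i => v t (S i)) n - m0 (v t)) < eps / 2) in hn.
  rewrite sum_n_Reals in hn. apply Rabs_def2 in hn.
  assert (hlim : filterlim (fun s => sum_f_R0 (fun i => v s (S i)) n) (at_right t)
    (locally (sum_f_R0 (fun i => v t (S i)) n))).
  { apply (filterlim_sum_f_R0 (fun i s => v s (S i))). intros i.
    apply solution_right_continuous; [exact hv|lia|exact ht]. }
  generalize (filter_and _ _
    (proj1 (filterlim_locally _ _) hlim (mkposreal _ heps2)) (at_right_lt t)).
  apply filter_imp. intros s [hs hts].
  change (Rabs (sum_f_R0 (fun i => v s (S i)) n - sum_f_R0 (fun i => v t (S i)) n)
    < eps / 2) in hs.
  apply Rabs_def2 in hs.
  change (Rabs (m0 (v s) - m0 (v t)) < eps).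
  assert (hle : sum_f_R0 (fun i => v s (S i)) n <= m0 (v s))
    by (apply sum_le_m0, hv; lra).
  assert (hdecr : m0 (v s) <= m0 (v t)) by (apply solution_m0_decr; [exact hv|lra]).
  pose proof (cond_pos eps). apply Rabs_def1; lra.
Qed.

Lemma conv_right_continuous (v : R -> nat -> R) (k : nat) (t : R) :
  critical_solution v -> 0 <= t ->
  filterlim (fun s => conv (v s) k) (at_right t) (locally (conv (v t) k)).
Proof.
  intros hv ht. unfold conv.
  assert (hin : forall l, In l (seq 1 (k - 1)) -> (1 <= l < k)%nat)
    by (intros l hl; apply in_seq in hl; lia).
  induction (seq 1 (k - 1)) as [|l s IH]; simpl; [apply filterlim_const|].
  assert (hl := hin l (or_introl eq_refl)).
  apply filterlim_Rplus.
  - apply filterlim_Rmult; apply solution_right_continuous; try assumption; lia.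
  - apply IH. intros j hj. apply hin. now right.
Qed.

(** One-sided fundamental theorem of calculus: the integrand is right-continuous at [t], so its
    average over [[t, s]] tends to its value at [t]. *)
Lemma solution_right_derivative (v : R -> nat -> R) (k : nat) (t : R) :
  critical_solution v -> (1 <= k)%nat -> 0 <= t ->
  right_derivative (fun s => v s k) t (rhs v k t).
Proof.
  intros hv hk ht.
  assert (hlim : filterlim (rhs v k) (at_right t) (locally (rhs v k t))).
  { unfold rhs, Rminus. apply filterlim_Rplus.
    - apply filterlim_Rmult; [apply filterlim_const|now apply conv_right_continuous].
    - replace (- (INR k * v t k * m0 (v t))) with (- INR k * v t k * m0 (v t)) by ring.
      eapply filterlim_ext with (fun s => - INR k * v s k * m0 (v s));
        [intros s; real_eq; ring|].
      apply filterlim_Rmult; [|now apply m0_right_continuous].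
      apply filterlim_Rmult; [apply filterlim_const|now apply solution_right_continuous]. }
  apply filterlim_locally. intros eps.
  assert (heps2 : 0 < eps / 2) by (pose proof (cond_pos eps); lra).
  destruct (proj1 (filterlim_locally _ _) hlim (mkposreal _ heps2)) as [d hd].
  exists d. intros s hs hts.
  change (Rabs (s - t) < d) in hs. apply Rabs_def2 in hs.
  change (Rabs ((v s k - v t k) / (s - t) - rhs v k t) < eps).
  assert (hbound : Rabs ((v s k - v t k) - (s - t) * rhs v k t) <= (s - t) * (eps / 2)).
  { apply (norm_RInt_le_const (fun x => minus (rhs v k x) (rhs v k t)) t s); [lra| |].
    - intros x hx. change (Rabs (rhs v k x - rhs v k t) <= eps / 2).
      destruct (Req_dec t x) as [<-|hne]; [rewrite Rminus_diag, Rabs_R0; lra|].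
      left. apply (hd x); [|lra]. change (Rabs (x - t) < d). rewrite Rabs_pos_eq; lra.
    - apply (is_RInt_minus (rhs v k) (fun _ => rhs v k t)).
      + apply solution_increment; [exact hv|lra|lra|exact hk].
      + apply (is_RInt_const t s (rhs v k t)). }
  replace ((v s k - v t k) / (s - t) - rhs v k t)
    with ((v s k - v t k - (s - t) * rhs v k t) / (s - t)) by (field; lra).
  unfold Rdiv. rewrite Rabs_mult, (Rabs_pos_eq (/ (s - t)))
    by (left; apply Rinv_0_lt_compat; lra).
  apply Rle_lt_trans with ((s - t) * (eps / 2) * / (s - t)).
  - apply Rmult_le_compat_r; [left; apply Rinv_0_lt_compat; lra|exact hbound].
  - replace ((s - t) * (eps / 2) * / (s - t)) with (eps / 2) by (field; lra). lra.
Qed.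

(** * Positivity, monotonicity and convexity of the first component *)

Lemma solution_1_right_derivative (v : R -> nat -> R) (t : R) :
  critical_solution v -> 0 <= t ->
  right_derivative (fun s => v s 1%nat) t (- m0 (v t) * v t 1%nat).
Proof.
  intros hv ht.
  (* For [k = 1] the gain term is an empty sum. *)
  replace (- m0 (v t) * v t 1%nat) with (rhs v 1 t) by (unfold rhs, conv; simpl; field).
  now apply solution_right_derivative.
Qed.

(** With [m] the initial mass, [v_1 exp(m t)] has right derivative [(m - m_0) v_1 exp(m t) >= 0], so
    it stays at least [v_1(0) > 0]. *)
Lemma solution_1_pos (v : R -> nat -> R) (t : R) :
  critical_solution v -> 0 < v 0 1%nat -> 0 <= t -> 0 < v t 1%nat.
Proof.
  intros hv h1 ht. set (m := m0 (v 0)).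
  set (E := fun s => exp (m * s)).
  assert (hE : forall s, is_derive E s (m * E s)).
  { intros s. unfold E. auto_derive; [trivial|ring]. }
  assert (h : v 0 1%nat * E 0 <= v t 1%nat * E t).
  { apply (right_derivative_nonneg_incr (fun s => v s 1%nat * E s)
      (fun s => - m0 (v s) * v s 1%nat * E s + v s 1%nat * (m * E s))); [exact ht| |].
    - intros s hs. apply (continuous_mult (fun s => v s 1%nat) E).
      + apply solution_continuous; [exact hv|lia|lra].
      + apply (ex_derive_continuous E). eexists. apply hE.
    - intros s hs. split.
      + apply right_derivative_mult; [apply solution_1_right_derivative; [exact hv|lra]|].
        apply right_derivative_of_is_derive, hE.
      + replace (- m0 (v s) * v s 1%nat * E s + v s 1%nat * (m * E s))
          with ((m - m0 (v s)) * (v s 1%nat * E s)) by ring.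
        assert (m0 (v s) <= m) by (apply solution_m0_decr; [exact hv|lra]).
        pose proof (solution_bounds v s 1 hv ltac:(lra) ltac:(lia)).
        assert (0 < E s) by apply exp_pos.
        apply Rmult_le_pos; [lra|apply Rmult_le_pos; lra]. }
  assert (0 < E 0) by apply exp_pos. assert (0 < E t) by apply exp_pos.
  nra.
Qed.

Lemma solution_m0_pos (v : R -> nat -> R) (t : R) :
  critical_solution v -> 0 <= t -> 0 < m0 (v t).
Proof. intros (_ & _ & _ & h) ht. specialize (h t ht). lra. Qed.

Lemma solution_1_decr (v : R -> nat -> R) (s t : R) :
  critical_solution v -> 0 <= s <= t -> v t 1%nat <= v s 1%nat.
Proof.
  intros hv hst.
  enough (-1 * v s 1%nat <= -1 * v t 1%nat) by lra.
  apply (right_derivative_nonneg_incr (fun u => -1 * v u 1%nat)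
    (fun u => -1 * (- m0 (v u) * v u 1%nat))); [lra| |].
  - intros u hu. apply (continuous_mult (fun _ => -1) (fun u => v u 1%nat)).
    + apply continuous_const.
    + apply solution_continuous; [exact hv|lia|lra].
  - intros u hu. split.
    + apply right_derivative_scal, solution_1_right_derivative; [exact hv|lra].
    + pose proof (solution_bounds v u 1 hv ltac:(lra) ltac:(lia)).
      pose proof (solution_m0_pos v u hv ltac:(lra)). nra.
Qed.

(* [v_1] is convex, with slope [- m_0 v_1]. *)
Lemma solution_1_supporting_line (v : R -> nat -> R) (s t : R) :
  critical_solution v -> 0 <= s -> 0 <= t ->
  m0 (v t) * v t 1%nat * (t - s) <= v s 1%nat - v t 1%nat.
Proof.
  intros hv hs ht.
  assert (hmono : forall x y, 0 <= x <= y ->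
    0 <= m0 (v y) * v y 1%nat <= m0 (v x) * v x 1%nat).
  { intros x y hxy.
    pose proof (solution_bounds v y 1 hv ltac:(lra) ltac:(lia)).
    pose proof (solution_m0_pos v y hv ltac:(lra)).
    pose proof (solution_1_decr v x y hv hxy).
    pose proof (solution_m0_decr v x y hv hxy).
    split; [apply Rmult_le_pos; lra|apply Rmult_le_compat; lra]. }
  (* [-c] is the slope at [t]. By [hmono], [v_1(u) + c u] decreases before [t] and increases after
     it; the sign [e] below treats both sides by one monotonicity criterion. *)
  set (c := m0 (v t) * v t 1%nat).
  assert (hcont : forall e u, 0 < u -> continuous (fun u => e * (v u 1%nat + c * u)) u).
  { intros e u hu.
    apply (continuous_mult (fun _ => e)); [apply continuous_const|].
    apply (continuous_plus (fun u => v u 1%nat) (fun u => c * u)).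
    - apply solution_continuous; [exact hv|lia|exact hu].
    - apply (ex_derive_continuous (fun u => c * u)). auto_derive. trivial. }
  assert (hder : forall e u, 0 <= u -> right_derivative (fun u => e * (v u 1%nat + c * u)) u
    (e * (- m0 (v u) * v u 1%nat + c))).
  { intros e u hu. apply (right_derivative_scal e (fun u => v u 1%nat + c * u)).
    apply (right_derivative_plus (fun u => v u 1%nat) (fun u => c * u));
      [now apply solution_1_right_derivative|].
    apply right_derivative_of_is_derive. auto_derive; [trivial|ring]. }
  destruct (Rle_lt_dec t s) as [hts|hst].
  - enough (1 * (v t 1%nat + c * t) <= 1 * (v s 1%nat + c * s)) by lra.
    apply (right_derivative_nonneg_incr (fun u => 1 * (v u 1%nat + c * u))
      (fun u => 1 * (- m0 (v u) * v u 1%nat + c)) t s hts).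
    + intros u hu. apply hcont. lra.
    + intros u hu. split; [apply hder; lra|].
      pose proof (hmono t u ltac:(lra)). unfold c. lra.
  - enough (-1 * (v s 1%nat + c * s) <= -1 * (v t 1%nat + c * t)) by lra.
    apply (right_derivative_nonneg_incr (fun u => -1 * (v u 1%nat + c * u))
      (fun u => -1 * (- m0 (v u) * v u 1%nat + c)) s t); [lra| |].
    + intros u hu. apply hcont. lra.
    + intros u hu. split; [apply hder; lra|].
      pose proof (hmono u t ltac:(lra)). unfold c. lra.
Qed.

(** * Comparison with monodisperse solutions *)

(** The system is triangular: [conv] at [k] involves only indices below [k] and is monotone on
    nonnegative sequences. Strong induction on [k] therefore makes [q_k - p_k] nondecreasing. *)
Lemma coagulation_comparison (p q : R -> nat -> R) :
  (forall k t, (1 <= k)%nat -> 0 < t -> continuous (fun s => p s k) t) ->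
  (forall k t, (1 <= k)%nat -> 0 < t -> continuous (fun s => q s k) t) ->
  (forall k t, (1 <= k)%nat -> 0 <= t ->
    right_derivative (fun s => p s k) t (INR k / 2 * conv (p t) k)) ->
  (forall k t, (1 <= k)%nat -> 0 <= t ->
    right_derivative (fun s => q s k) t (INR k / 2 * conv (q t) k)) ->
  (forall k t, (1 <= k)%nat -> 0 <= t -> 0 <= p t k) ->
  (forall k, (1 <= k)%nat -> p 0 k <= q 0 k) ->
  forall k t, (1 <= k)%nat -> 0 <= t -> p t k <= q t k.
Proof.
  intros hpc hqc hpd hqd hp h0 k.
  induction k as [k IH] using (well_founded_induction Nat.lt_wf_0). intros t hk ht.
  enough (q 0 k + -1 * p 0 k <= q t k + -1 * p t k) by (specialize (h0 k hk); lra).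
  apply (right_derivative_nonneg_incr (fun s => q s k + -1 * p s k)
    (fun s => INR k / 2 * conv (q s) k + -1 * (INR k / 2 * conv (p s) k))); [exact ht| |].
  - intros s hs. apply (continuous_plus (fun s => q s k) (fun s => -1 * p s k)).
    + apply hqc; [exact hk|lra].
    + apply (continuous_mult (fun _ => -1)); [apply continuous_const|].
      apply hpc; [exact hk|lra].
  - intros s hs. split.
    + apply (right_derivative_plus (fun s => q s k)); [apply hqd; [exact hk|lra]|].
      apply (right_derivative_scal (-1) (fun s => p s k)). apply hpd; [exact hk|lra].
    + assert (hc : conv (p s) k <= conv (q s) k).
      { apply conv_le. intros l hl. split; [apply hp; [lia|lra]|].
        apply IH; [lia|lia|lra]. }
      assert (INR k / 2 * conv (p s) k <= INR k / 2 * conv (q s) k); [|lra].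
      apply Rmult_le_compat_l; [pose proof (pos_INR k); lra|exact hc].
Qed.

(** For [d = 0] the initial value is 1 at [k = 1] and 0 at larger [k]; [d] shifts this solution in
    time. *)
Definition monodisperse (d t : R) (k : nat) : R := tau k * (t + d) ^ (k - 1).

(** Every product in the convolution carries the power [(t + d)^(k-2)], and [conv_tau] supplies the
    coefficient. For [k = 1] both sides vanish. *)
Lemma monodisperse_is_derive (d t : R) (k : nat) : (1 <= k)%nat ->
  is_derive (fun s => monodisperse d s k) t (INR k / 2 * conv (monodisperse d t) k).
Proof.
  intros hk. unfold monodisperse.
  assert (hder : is_derive (fun s => tau k * (s + d) ^ (k - 1)) t
    (tau k * (INR (k - 1) * (t + d) ^ pred (k - 1)))).
  { auto_derive; [trivial|ring]. }
  replace (INR k / 2 * conv (fun l => tau l * (t + d) ^ (l - 1)) k)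
    with (tau k * (INR (k - 1) * (t + d) ^ pred (k - 1))); [exact hder|].
  destruct k as [|[|n]]; [lia|unfold conv; simpl; ring|].
  assert (hconv : conv (fun l => tau l * (t + d) ^ (l - 1)) (S (S n))
    = conv tau (S (S n)) * (t + d) ^ n).
  { unfold conv. replace (S (S n) - 1)%nat with (S n) by lia.
    rewrite !fold_right_Rplus_seq, Rmult_comm, scal_sum.
    apply sum_eq. intros i hi.
    replace ((t + d) ^ n) with ((t + d) ^ (1 + i - 1) * (t + d) ^ (S (S n) - (1 + i) - 1))
      by (rewrite <- pow_add; f_equal; lia).
    ring. }
  rewrite hconv, <- (Rmult_assoc (INR _ / 2)), conv_tau by lia.
  replace (pred (S (S n) - 1)) with n by lia. ring.
Qed.

(* Dividing [v_k] by [v_1^k] removes the loss term [- k v_k m_0]. *)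
Lemma rescaled_right_derivative (v : R -> nat -> R) (k : nat) (t : R) :
  critical_solution v -> 0 < v 0 1%nat -> (1 <= k)%nat -> 0 <= t ->
  right_derivative (fun s => v s k * (/ v s 1%nat) ^ k) t
    (INR k / 2 * conv (fun l => v t l * (/ v t 1%nat) ^ l) k).
Proof.
  intros hv h1 hk ht. rewrite conv_scale.
  (* The logarithmic derivative of [1 / v_1] is [m_0]; its [k]-th power contributes [k m_0], which
     cancels the loss term. *)
  assert (hE : right_derivative (fun s => / v s 1%nat) t (m0 (v t) * / v t 1%nat)).
  { pose proof (solution_1_pos v t hv h1 ht) as hpos.
    replace (m0 (v t) * / v t 1%nat)
      with (- (- m0 (v t) * v t 1%nat) * / v t 1%nat * / v t 1%nat) by (field; lra).
    apply (right_derivative_inv (fun s => v s 1%nat)).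
    - intros s hs. apply Rgt_not_eq, solution_1_pos; [exact hv|exact h1|lra].
    - now apply solution_1_right_derivative. }
  replace (INR k / 2 * (conv (v t) k * (/ v t 1%nat) ^ k))
    with (rhs v k t * (/ v t 1%nat) ^ k
      + v t k * (INR k * m0 (v t) * (/ v t 1%nat) ^ k)) by (unfold rhs; ring).
  apply (right_derivative_mult (fun s => v s k)).
  - now apply solution_right_derivative.
  - now apply (right_derivative_pow (fun s => / v s 1%nat)).
Qed.

Lemma rescaled_continuous (v : R -> nat -> R) (k : nat) (t : R) :
  critical_solution v -> 0 < v 0 1%nat -> (1 <= k)%nat -> 0 < t ->
  continuous (fun s => v s k * (/ v s 1%nat) ^ k) t.
Proof.
  intros hv h1 hk ht.
  apply (continuous_mult (fun s => v s k)); [now apply solution_continuous|].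
  apply (continuous_comp (fun s => / v s 1%nat) (fun x => x ^ k)).
  - apply (continuous_comp (fun s => v s 1%nat) Rinv); [apply solution_continuous; [exact hv|lia|lra]|].
    apply continuous_Rinv, Rgt_not_eq, solution_1_pos; [exact hv|exact h1|lra].
  - apply (ex_derive_continuous (fun x => x ^ k)). auto_derive. trivial.
Qed.

(** The rescaled solution [w] lies between [monodisperse 0] and [monodisperse d], because it does so
    at time 0; multiplying by [v_1^k] undoes the rescaling. *)
Lemma solution_comparison (v : R -> nat -> R) (d : R) :
  critical_solution v -> 0 < v 0 1%nat -> 0 <= d ->
  (forall k, (1 <= k)%nat -> v 0 k * (/ v 0 1%nat) ^ k <= tau k * d ^ (k - 1)) ->
  forall k t, (1 <= k)%nat -> 0 <= t ->
  tau k * t ^ (k - 1) * v t 1%nat ^ k <= v t k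
    <= tau k * (t + d) ^ (k - 1) * v t 1%nat ^ k.
Proof.
  intros hv h1 hd h0 k t hk ht.
  set (w := fun s l => v s l * (/ v s 1%nat) ^ l).
  assert (hmc : forall e l s, (1 <= l)%nat -> 0 < s ->
    continuous (fun s => monodisperse e s l) s).
  { intros e l s hl _. apply (ex_derive_continuous (fun s => monodisperse e s l)).
    eexists. now apply monodisperse_is_derive. }
  assert (hmd : forall e l s, (1 <= l)%nat -> 0 <= s ->
    right_derivative (fun s => monodisperse e s l) s
      (INR l / 2 * conv (monodisperse e s) l)).
  { intros e l s hl _. apply right_derivative_of_is_derive.
    now apply monodisperse_is_derive. }
  assert (hwc : forall l s, (1 <= l)%nat -> 0 < s -> continuous (fun s => w s l) s)
    by (intros; now apply rescaled_continuous).
  assert (hwd : forall l s, (1 <= l)%nat -> 0 <= s ->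
    right_derivative (fun s => w s l) s (INR l / 2 * conv (w s) l))
    by (intros; now apply rescaled_right_derivative).
  assert (hw0 : forall l s, (1 <= l)%nat -> 0 <= s -> 0 <= w s l).
  { intros l s hl hs. apply Rmult_le_pos.
    - now apply (solution_bounds v s l).
    - apply pow_le. left. apply Rinv_0_lt_compat. now apply solution_1_pos. }
  assert (hlow : monodisperse 0 t k <= w t k).
  { apply (coagulation_comparison (monodisperse 0) w); auto.
    - intros l s hl hs. apply Rmult_le_pos; [left; now apply tau_pos|].
      apply pow_le. lra.
    (* At time 0 the lower solution is 1 for [l = 1], as is [w], and 0 for larger [l]. *)
    - intros l hl. unfold monodisperse. destruct l as [|[|l]]; [lia| |].
      + unfold w, tau. simpl. right. field. lra.
      + replace (S (S l) - 1)%nat with (S l) by lia.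
        replace (tau (S (S l)) * (0 + 0) ^ S l) with 0 by (simpl; ring).
        apply hw0; [lia|lra]. }
  assert (hup : w t k <= monodisperse d t k).
  { apply (coagulation_comparison w (monodisperse d)); auto.
    intros l hl. unfold monodisperse. rewrite Rplus_0_l. now apply h0. }
  pose proof (solution_1_pos v t hv h1 ht) as hpos.
  assert (hpk : 0 < v t 1%nat ^ k) by now apply pow_lt.
  assert (heq : v t k = w t k * v t 1%nat ^ k).
  { unfold w. rewrite Rmult_assoc, <- Rpow_mult_distr, Rinv_l, pow1 by lra. ring. }
  unfold monodisperse in hlow, hup. rewrite Rplus_0_r in hlow.
  rewrite heq. split; apply Rmult_le_compat_r; lra.
Qed.

Lemma finite_upper_bound (B : nat -> R) (N : nat) :
  exists D, 1 <= D /\ forall k, (k <= N)%nat -> B k <= D.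
Proof.
  induction N as [|N (D & hD & h)].
  - exists (Rmax 1 (B 0%nat)). split; [apply Rmax_l|].
    intros k hk. replace k with 0%nat by lia. apply Rmax_r.
  - exists (Rmax D (B (S N))). split; [apply Rle_trans with D; [exact hD|apply Rmax_l]|].
    intros k hk. destruct (Nat.eq_dec k (S N)) as [->|hne]; [apply Rmax_r|].
    apply Rle_trans with D; [apply h; lia|apply Rmax_l].
Qed.

(** Take [d >= 1] above the finitely many ratios of [v_k / v_1^k] to [tau k] up to the end of the
    support. Then [d <= d^(k-1)] settles [k >= 2], both sides are 1 at [k = 1], and the left side is
    0 beyond the support. *)
Lemma initial_domination (v0 : nat -> R) :
  inNstar v0 -> 0 < v0 1%nat ->
  exists d, 1 <= d /\
  forall k, (1 <= k)%nat -> v0 k * (/ v0 1%nat) ^ k <= tau k * d ^ (k - 1).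
Proof.
  intros [_ [N hN]] h1.
  destruct (finite_upper_bound (fun k => v0 k * (/ v0 1%nat) ^ k / tau k) N) as (D & hD & h).
  exists D. split; [exact hD|]. intros k hk.
  pose proof (tau_pos k hk) as htau.
  destruct (Nat.le_gt_cases k N) as [hkN|hkN].
  - destruct k as [|[|k]]; [lia|unfold tau; simpl; right; field; lra|].
    specialize (h _ hkN). cbv beta in h.
    set (x := v0 (S (S k)) * (/ v0 1%nat) ^ S (S k)) in *.
    replace x with (tau (S (S k)) * (x / tau (S (S k)))) by (field; lra).
    apply Rmult_le_compat_l; [lra|]. apply Rle_trans with (1 := h).
    replace (S (S k) - 1)%nat with (S k) by lia. simpl.
    pose proof (pow_R1_Rle D k hD). nra.
  - rewrite (hN k hkN), Rmult_0_l. apply Rmult_le_pos; [lra|]. apply pow_le. lra.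
Qed.

(** * Limits *)

(* Otherwise the lower bound on [v_k] makes the total mass infinite. *)
Lemma solution_1_le (v : R -> nat -> R) (d t : R) :
  critical_solution v -> 0 < v 0 1%nat -> 0 <= d -> 0 <= t ->
  (forall k, (1 <= k)%nat -> v 0 k * (/ v 0 1%nat) ^ k <= tau k * d ^ (k - 1)) ->
  t * v t 1%nat <= exp (-1).
Proof.
  intros hv h1 hd ht h0.
  pose proof (solution_1_pos v t hv h1 ht) as hpos.
  set (s := t * v t 1%nat).
  assert (hs : 0 <= s) by (apply Rmult_le_pos; lra).
  pose proof (exp_pos 1) as he. pose proof (exp_pos (-1)) as he'.
  pose proof exp_1_mult_exp_opp_1 as hee.
  enough (exp 1 * s <= 1) by nra.
  (* With [s = t v_1], the lower bound gives [tau (n+1) s^n v_1 <= v_(n+1) <= m_0(0)]. Inserting the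
     growth of [tau] bounds [(e s)^n] by this constant times [(n+1)^2]. *)
  apply geometric_le_quadratic with (m0 (v 0) / v t 1%nat); [nra|].
  intros n. rewrite Rpow_mult_distr.
  apply Rle_trans with (INR (S n) ^ 2 * tau (S n) * s ^ n).
  { apply Rmult_le_compat_r; [now apply pow_le|apply tau_lower_bound]. }
  rewrite (Rmult_comm _ (INR (S n) ^ 2)), Rmult_assoc.
  apply Rmult_le_compat_l; [apply pow_le, pos_INR|].
  apply Rmult_le_reg_r with (v t 1%nat); [exact hpos|].
  replace (m0 (v 0) / v t 1%nat * v t 1%nat) with (m0 (v 0)) by (field; lra).
  apply Rle_trans with (v t (S n)); [|apply solution_bounds; [exact hv|exact ht|lia]].
  replace (tau (S n) * s ^ n * v t 1%nat)
    with (tau (S n) * t ^ (S n - 1) * v t 1%nat ^ S n).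
  - apply (solution_comparison v d); auto. lia.
  - unfold s. rewrite Rpow_mult_distr. replace (S n - 1)%nat with n by lia. simpl. ring.
Qed.

(** Termwise, [(t + d) v_k <= tau k ((t + d) v_1)^k <= tau k a^k], and the partial sums of the right
    side are at most [a e]. *)
Lemma m0_upper_bound (v : R -> nat -> R) (d t a : R) :
  critical_solution v -> 0 < v 0 1%nat -> 0 < d -> 0 <= t ->
  (forall k, (1 <= k)%nat -> v 0 k * (/ v 0 1%nat) ^ k <= tau k * d ^ (k - 1)) ->
  (t + d) * v t 1%nat <= a -> a <= exp (-1) ->
  (t + d) * m0 (v t) <= a * exp 1.
Proof.
  intros hv h1 hd ht h0 hra ha.
  pose proof (solution_1_pos v t hv h1 ht) as hpos.
  assert (hr : 0 < (t + d) * v t 1%nat) by (apply Rmult_lt_0_compat; lra).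
  apply Rmult_le_reg_r with (/ (t + d)); [apply Rinv_0_lt_compat; lra|].
  replace ((t + d) * m0 (v t) * / (t + d)) with (m0 (v t)) by (field; lra).
  apply m0_le; [now apply hv|]. intros n.
  apply Rmult_le_reg_r with (t + d); [lra|].
  replace (a * exp 1 * / (t + d) * (t + d)) with (a * exp 1) by (field; lra).
  apply Rle_trans with (2 := sum_tau_le a n ltac:(lra)).
  rewrite Rmult_comm, scal_sum. apply sum_Rle. intros i _.
  apply Rle_trans with (tau (S i) * ((t + d) * v t 1%nat) ^ S i).
  - replace (tau (S i) * ((t + d) * v t 1%nat) ^ S i)
      with (tau (S i) * (t + d) ^ (S i - 1) * v t 1%nat ^ S i * (t + d)).
    + apply Rmult_le_compat_r; [lra|].
      apply (solution_comparison v d); auto; [lra|lia].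
    + rewrite Rpow_mult_distr. replace (S i - 1)%nat with i by lia. simpl. ring.
  - apply Rmult_le_compat_l; [left; apply tau_pos; lia|]. apply pow_incr. lra.
Qed.

(* As long as [r = (t + d) v_1] is below [a < 1/e] it satisfies
   [r' >= (1 - a e) r / (t + d)], so it reaches the level [a] and stays above it. *)
Lemma solution_1_eventually_ge (v : R -> nat -> R) (d a : R) :
  critical_solution v -> 0 < v 0 1%nat -> 0 < d ->
  (forall k, (1 <= k)%nat -> v 0 k * (/ v 0 1%nat) ^ k <= tau k * d ^ (k - 1)) ->
  0 < a < exp (-1) ->
  exists T, 0 <= T /\ forall t, T <= t -> a <= (t + d) * v t 1%nat.
Proof.
  intros hv h1 hd h0 ha.
  set (r := fun t => (t + d) * v t 1%nat).
  set (dr := fun t => 1 * v t 1%nat + (t + d) * (- m0 (v t) * v t 1%nat)).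
  assert (hcont : forall t, 0 < t -> continuous r t).
  { intros t ht. apply (continuous_mult (fun t => t + d) (fun t => v t 1%nat)).
    - apply (ex_derive_continuous (fun t => t + d)). auto_derive. trivial.
    - apply solution_continuous; [exact hv|lia|exact ht]. }
  assert (hder : forall t, 0 <= t -> right_derivative r t (dr t)).
  { intros t ht. apply (right_derivative_mult (fun t => t + d) (fun t => v t 1%nat)).
    - apply right_derivative_of_is_derive. auto_derive; [trivial|ring].
    - now apply solution_1_right_derivative. }
  set (theta := 1 - a * exp 1).
  assert (htheta : 0 < theta).
  { pose proof exp_1_mult_exp_opp_1. pose proof (exp_pos 1). unfold theta. nra. }
  assert (hdr : forall t, 0 <= t -> r t <= a -> theta * v t 1%nat <= dr t).
  { intros t ht hra.
    pose proof (m0_upper_bound v d t a hv h1 hd ht h0 hra ltac:(lra)) as hm.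
    pose proof (solution_1_pos v t hv h1 ht).
    replace (dr t) with ((1 - (t + d) * m0 (v t)) * v t 1%nat) by (unfold dr; ring).
    apply Rmult_le_compat_r; unfold theta; lra. }
  (* If [r] stayed below [a], it would increase, so [v_1 >= r(0) / (t + d)] and
     [r' >= theta r(0) / (t + d)]. Then [r] would grow logarithmically and pass [a]. *)
  assert (hreach : exists t1, 0 <= t1 /\ a <= r t1).
  { apply Classical_Prop.NNPP. intros hn.
    assert (hlt : forall t, 0 <= t -> r t < a).
    { intros t ht. apply Rnot_le_lt. intros h. apply hn. now exists t. }
    assert (hr0 : 0 < r 0).
    { unfold r. apply Rmult_lt_0_compat; lra. }
    assert (hincr : forall t, 0 <= t -> r 0 <= r t).
    { intros t ht. apply (right_derivative_nonneg_incr r dr); [exact ht| |].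
      - intros s hs. apply hcont. lra.
      - intros s hs. split; [apply hder; lra|].
        apply Rle_trans with (theta * v s 1%nat).
        + apply Rmult_le_pos; [lra|]. left. apply solution_1_pos; [exact hv|exact h1|lra].
        + apply hdr; [lra|]. left. apply hlt. lra. }
    (* Chosen so that at [t + d = d exp(B)] the logarithmic gain [theta r(0) B] is exactly [a],
       whence [r t >= r 0 + a > a]. *)
    set (B := a / (theta * r 0)).
    assert (hB : 0 < B) by (apply Rdiv_lt_0_compat; [lra|now apply Rmult_lt_0_compat]).
    set (t := d * exp B - d).
    assert (ht : 0 <= t).
    { unfold t. pose proof (exp_ineq1_le B). nra. }
    assert (hlog : r 0 + - (theta * r 0) * ln (0 + d) <= r t + - (theta * r 0) * ln (t + d)).
    { apply (right_derivative_nonneg_incr (fun s => r s + - (theta * r 0) * ln (s + d))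
        (fun s => dr s + - (theta * r 0) * / (s + d))); [exact ht| |].
      - intros s hs. apply (continuous_plus r); [apply hcont; lra|].
        apply (ex_derive_continuous (fun s => - (theta * r 0) * ln (s + d))).
        auto_derive. lra.
      - intros s hs. split.
        + apply (right_derivative_plus r); [apply hder; lra|].
          apply right_derivative_scal, right_derivative_of_is_derive.
          auto_derive; [lra|field; lra].
        + enough (theta * r 0 * / (s + d) <= theta * v s 1%nat).
          { specialize (hdr s ltac:(lra) (Rlt_le _ _ (hlt s ltac:(lra)))). lra. }
          rewrite Rmult_assoc. apply Rmult_le_compat_l; [lra|].
          apply Rmult_le_reg_r with (s + d); [lra|].
          rewrite Rmult_assoc, Rinv_l, Rmult_1_r by lra.
          specialize (hincr s ltac:(lra)). unfold r at 2 in hincr. lra. }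
    rewrite Rplus_0_l in hlog.
    replace (t + d) with (d * exp B) in hlog by (unfold t; ring).
    rewrite ln_mult, ln_exp in hlog by (try apply exp_pos; exact hd).
    assert (theta * r 0 * B = a) by (unfold B; field; lra).
    specialize (hlt t ht). lra. }
  destruct hreach as (t1 & ht1 & hr1).
  exists t1. split; [exact ht1|]. intros t ht.
  (* At level [a] the derivative of [r] is at least [theta v_1 > 0], so [r] never falls below [a]
     again. *)
  apply (right_derivative_barrier r t1 t a ht hr1).
  - intros s hs. apply hcont. lra.
  - intros s hs. exists (dr s). split; [apply hder; lra|]. intros heq.
    apply Rlt_le_trans with (theta * v s 1%nat).
    + apply Rmult_lt_0_compat; [exact htheta|]. apply solution_1_pos; [exact hv|exact h1|lra].
    + apply hdr; lra.
Qed.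

(** [t v_1 <= 1/e] holds at all times, while [(t + d) v_1] eventually exceeds any level below [1/e].
    The discrepancy [d v_1 <= d / (e t)] tends to 0. *)
Lemma solution_1_limit (v : R -> nat -> R) (d : R) :
  critical_solution v -> 0 < v 0 1%nat -> 0 < d ->
  (forall k, (1 <= k)%nat -> v 0 k * (/ v 0 1%nat) ^ k <= tau k * d ^ (k - 1)) ->
  is_lim (fun t => t * v t 1%nat) p_infty (exp (-1)).
Proof.
  intros hv h1 hd h0. apply is_lim_spec. intros eps.
  pose proof (cond_pos eps) as heps. pose proof (exp_pos (-1)) as he.
  (* Half of [eps] is left for the shift [d v_1]; the second entry keeps [a] positive. *)
  set (a := Rmax (exp (-1) - eps / 2) (exp (-1) / 2)).
  assert (ha1 : exp (-1) - eps / 2 <= a) by apply Rmax_l.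
  assert (ha2 : exp (-1) / 2 <= a) by apply Rmax_r.
  assert (ha3 : a < exp (-1)) by (apply Rmax_lub_lt; lra).
  destruct (solution_1_eventually_ge v d a hv h1 hd h0 ltac:(lra)) as (T & hT & hge).
  exists (Rmax T (2 * d * exp (-1) / eps)). intros t ht.
  pose proof (Rmax_l T (2 * d * exp (-1) / eps)).
  pose proof (Rmax_r T (2 * d * exp (-1) / eps)).
  specialize (hge t ltac:(lra)).
  pose proof (solution_1_le v d t hv h1 ltac:(lra) ltac:(lra) h0) as hle.
  assert (ht0 : 0 < t).
  { assert (0 < 2 * d * exp (-1) / eps); [|lra].
    apply Rdiv_lt_0_compat; [|lra]. apply Rmult_lt_0_compat; lra. }
  assert (hsmall : d * v t 1%nat < eps / 2).
  { apply Rmult_lt_reg_l with t; [exact ht0|].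
    apply Rle_lt_trans with (d * exp (-1)).
    - replace (t * (d * v t 1%nat)) with (d * (t * v t 1%nat)) by ring.
      apply Rmult_le_compat_l; lra.
    - replace (d * exp (-1)) with (2 * d * exp (-1) / eps * (eps / 2)) by (field; lra).
      apply Rmult_lt_compat_r; lra. }
  simpl. apply Rabs_def1; lra.
Qed.

Lemma filterlim_pow {T} {F : (T -> Prop) -> Prop} {FF : Filter F}
  (f : T -> R) (a : R) (n : nat) :
  filterlim f F (locally a) -> filterlim (fun x => f x ^ n) F (locally (a ^ n)).
Proof.
  intros hf. induction n as [|n IH]; simpl; [apply filterlim_const|].
  now apply filterlim_Rmult.
Qed.

Lemma is_lim_shift_ratio (d : R) : is_lim (fun t => (t + d) / t) p_infty 1.
Proof.
  apply is_lim_spec. intros eps. pose proof (cond_pos eps) as heps.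
  exists (Rabs d / eps). intros t ht.
  assert (ht0 : 0 < t).
  { apply Rle_lt_trans with (2 := ht). apply Rmult_le_pos; [apply Rabs_pos|].
    left. now apply Rinv_0_lt_compat. }
  simpl. replace ((t + d) / t - 1) with (d / t) by (field; lra).
  unfold Rdiv. rewrite Rabs_mult, (Rabs_pos_eq (/ t)) by (left; now apply Rinv_0_lt_compat).
  apply Rmult_lt_reg_r with t; [exact ht0|].
  rewrite Rmult_assoc, Rinv_l, Rmult_1_r by lra.
  apply Rmult_lt_compat_l with (r := eps) in ht; [|exact heps].
  replace (eps * (Rabs d / eps)) with (Rabs d) in ht by (field; lra). exact ht.
Qed.

(** Squeeze: multiplied by [t], the two comparison bounds are [tau k (t v_1)^k] and the same times
    [((t + d)/t)^(k-1)], a factor tending to 1. *)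
Lemma solution_limit (v : R -> nat -> R) (d : R) (k : nat) :
  critical_solution v -> 0 < v 0 1%nat -> 0 < d ->
  (forall k, (1 <= k)%nat -> v 0 k * (/ v 0 1%nat) ^ k <= tau k * d ^ (k - 1)) ->
  (1 <= k)%nat ->
  is_lim (fun t => t * v t k) p_infty (tau k * exp (-1) ^ k).
Proof.
  intros hv h1 hd h0 hk.
  assert (hlow : is_lim (fun t => tau k * (t * v t 1%nat) ^ k) p_infty (tau k * exp (-1) ^ k)).
  { apply (filterlim_Rmult (fun _ => tau k)); [apply filterlim_const|].
    apply filterlim_pow, (solution_1_limit v d); assumption. }
  apply is_lim_le_le_loc with (fun t => tau k * (t * v t 1%nat) ^ k)
    (fun t => tau k * (t * v t 1%nat) ^ k * ((t + d) / t) ^ (k - 1)).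
  - exists 0. intros t ht.
    destruct (solution_comparison v d hv h1 ltac:(lra) h0 k t hk ltac:(lra)) as [hl hu].
    destruct k as [|n]; [lia|]. replace (S n - 1)%nat with n in * by lia.
    split.
    + replace (tau (S n) * (t * v t 1%nat) ^ S n)
        with (t * (tau (S n) * t ^ n * v t 1%nat ^ S n))
        by (rewrite Rpow_mult_distr; simpl; ring).
      apply Rmult_le_compat_l; lra.
    + replace (tau (S n) * (t * v t 1%nat) ^ S n * ((t + d) / t) ^ n)
        with (t * (tau (S n) * (t + d) ^ n * v t 1%nat ^ S n)).
      * apply Rmult_le_compat_l; lra.
      * replace ((t + d) ^ n) with (((t + d) / t) ^ n * t ^ n)
          by (rewrite <- Rpow_mult_distr; f_equal; field; lra).
        rewrite Rpow_mult_distr. simpl. ring.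
  - exact hlow.
  - replace (tau k * exp (-1) ^ k) with (tau k * exp (-1) ^ k * 1 ^ (k - 1))
      by (rewrite pow1; ring).
    apply (filterlim_Rmult _ (fun t => ((t + d) / t) ^ (k - 1)) _ _ hlow).
    apply filterlim_pow. exact (is_lim_shift_ratio d).
Qed.

(** * Asymptotics of the total mass *)

(** The supporting line at [t], evaluated at [mu t], gives [(1 - mu) t m_0(t) <= v_1(mu t) / v_1(t)
    - 1], whose right side tends to [1/mu - 1]. Keeping the factor [1 - mu] yields an upper bound on
    [t m_0] for [mu < 1] and a lower one for [mu > 1]. *)
Lemma m0_scaled_eventually (v : R -> nat -> R) (mu c : R) :
  critical_solution v -> 0 < v 0 1%nat ->
  is_lim (fun t => t * v t 1%nat) p_infty (exp (-1)) ->
  0 < mu -> (1 - mu) / mu < (1 - mu) * c ->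
  Rbar_locally' p_infty (fun t => (1 - mu) * (t * m0 (v t)) < (1 - mu) * c).
Proof.
  intros hv h1 hlim hmu hc.
  pose proof (exp_pos (-1)) as he.
  assert (hmul : filterlim (fun t => mu * t) (Rbar_locally' p_infty) (Rbar_locally' p_infty)).
  { intros P [M hM]. exists (M / mu). intros t ht. apply hM.
    apply Rmult_lt_compat_l with (r := mu) in ht; [|exact hmu].
    replace (mu * (M / mu)) with M in ht by (field; lra). exact ht. }
  assert (hratio : filterlim (fun t => (mu * t * v (mu * t) 1%nat) * / (t * v t 1%nat) * / mu)
    (Rbar_locally' p_infty) (locally (exp (-1) * / exp (-1) * / mu))).
  { apply filterlim_Rmult; [|apply filterlim_const].
    apply filterlim_Rmult.
    - exact (filterlim_comp _ _ _ _ (fun t => t * v t 1%nat) _ _ _ hmul hlim).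
    - apply filterlim_Rinv; [lra|exact hlim]. }
  rewrite Rinv_r, Rmult_1_l in hratio by lra.
  assert (hgap : 0 < (1 - mu) * c - (1 - mu) / mu) by lra.
  assert (hpos : Rbar_locally' p_infty (fun t => 0 < t)) by (exists 0; auto).
  generalize (filter_and _ _ (proj1 (filterlim_locally _ _) hratio (mkposreal _ hgap)) hpos).
  apply filter_imp. intros t [ht ht0].
  change (Rabs (mu * t * v (mu * t) 1%nat * / (t * v t 1%nat) * / mu - / mu)
    < (1 - mu) * c - (1 - mu) / mu) in ht.
  pose proof (solution_1_pos v t hv h1 ltac:(lra)) as hv1.
  assert (hmut : 0 < mu * t) by now apply Rmult_lt_0_compat.
  pose proof (solution_1_supporting_line v (mu * t) t hv ltac:(lra) ltac:(lra)) as hline.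
  replace (mu * t * v (mu * t) 1%nat * / (t * v t 1%nat) * / mu)
    with (v (mu * t) 1%nat / v t 1%nat) in ht by (field; lra).
  apply Rabs_def2 in ht.
  replace ((1 - mu) / mu) with (/ mu - 1) in ht by (field; lra).
  apply Rle_lt_trans with (v (mu * t) 1%nat / v t 1%nat - 1); [|lra].
  apply Rmult_le_reg_r with (v t 1%nat); [exact hv1|].
  replace ((v (mu * t) 1%nat / v t 1%nat - 1) * v t 1%nat)
    with (v (mu * t) 1%nat - v t 1%nat) by (field; lra).
  lra.
Qed.

Lemma m0_limit (v : R -> nat -> R) :
  critical_solution v -> 0 < v 0 1%nat ->
  is_lim (fun t => t * v t 1%nat) p_infty (exp (-1)) ->
  is_lim (fun t => t * m0 (v t)) p_infty 1.
Proof.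
  intros hv h1 hlim. apply is_lim_spec. intros eps. pose proof (cond_pos eps) as heps.
  assert (hup : Rbar_locally' p_infty (fun t => t * m0 (v t) < 1 + eps)).
  (* Here [1/mu = 1 + eps/2] lies strictly below the target [1 + eps]. *)
  { set (mu := / (1 + eps / 2)).
    assert (hmu0 : 0 < mu) by (apply Rinv_0_lt_compat; lra).
    assert (hmu1 : mu < 1) by (unfold mu; rewrite <- Rinv_1; apply Rinv_lt_contravar; lra).
    generalize (m0_scaled_eventually v mu (1 + eps) hv h1 hlim hmu0).
    intros h. assert (hc : (1 - mu) / mu < (1 - mu) * (1 + eps)).
    { apply Rmult_lt_compat_l; [lra|]. unfold mu. rewrite Rinv_inv. lra. }
    generalize (h hc). apply filter_imp. intros t ht.
    apply Rmult_lt_reg_l with (1 - mu); lra. }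
  assert (hlow : Rbar_locally' p_infty (fun t => 1 - eps < t * m0 (v t))).
  (* The choice is [mu = 1 + eps]; after multiplication by [1 + eps] the two sides differ by
     [eps^3]. *)
  { assert (hc : (1 - (1 + eps)) / (1 + eps) < (1 - (1 + eps)) * (1 - eps)).
    { apply Rmult_lt_reg_r with (1 + eps); [lra|].
      replace ((1 - (1 + eps)) / (1 + eps) * (1 + eps)) with (- eps) by (field; lra).
      pose proof (pow_lt eps 3 heps). simpl in *. lra. }
    generalize (m0_scaled_eventually v (1 + eps) (1 - eps) hv h1 hlim ltac:(lra) hc).
    apply filter_imp. intros t ht. apply Rmult_lt_reg_l with eps; lra. }
  generalize (filter_and _ _ hup hlow). apply filter_imp. intros t [hu hl].
  simpl. apply Rabs_def1; lra.
Qed.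

Theorem theorem7 (v : R -> nat -> R) :
  inNstar (v 0) -> 0 < v 0 1%nat -> critical_solution v ->
  (forall k : nat, (1 <= k)%nat ->
     is_lim (fun t => t * v t k) p_infty
            (INR k ^ (k - 1) / INR (fact k) * exp (- INR k))) /\
  is_lim (fun t => t * m0 (v t)) p_infty 1.
Proof.
  intros hN h1 hv.
  destruct (initial_domination (v 0) hN h1) as (d & hd & h0).
  split.
  - intros k hk.
    replace (- INR k) with (INR k * -1) by ring. rewrite exp_INR_mult.
    apply (solution_limit v d); auto. lra.
  - apply m0_limit; auto. apply (solution_1_limit v d); auto. lra.
Qed.
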